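(* Let $\mathbb K$ be $\mathbb R$ or $\mathbb C$. Let $f=A+\cdots$ be a formal power series vector field on $\mathbb K^n$ in Poincaré–Dulac normal form, let $g$ be a formal vector field and $\lambda=\lambda_0+\lambda_1+\cdots$ a formal power series such that $[f,g]=\lambda g$. Then there exists an invertible formal power series $\sigma=1+\cdots$ such that $g^*:=\sigma g$ satisfies the identity $[f,g^*]=\lambda^*g^*$, with a series $\lambda^*=\lambda_0+\lambda_1^*+\cdots$ that in turn satisfies $X_{A_s}(\lambda^* )=0$. Moreover $[A_s,g^*]=\lambda_0 g^*$.
   Context: A formal vector field on $\mathbb K^n$ is an element of $\mathbb K[[x_1,\ldots,x_n]]^n$, written as a sum of homogeneous polynomial maps; $f=A+\cdots$ means $f=A+\sum_{j\geq2}f_j$ with $f_j$ homogeneous of degree $j$ and $A\in\mathbb K^{(n,n)}$ identified with $x\mapsto Ax$. For formal power series, $\lambda_j,\lambda_j^*$ denote the homogeneous parts of degree $j$ (so $\lambda_0\in\mathbb K$), and $\sigma=1+\cdots$ means that $\sigma$ has constant term $1$. The Lie bracket is $[f,g]=Dg\, f-Df\, g$, and for a formal power series $\phi$ the Lie derivative is $X_f(\phi)=D\phi\cdot f$; in particular $X_{A_s}(\phi)(x)=D\phi(x)A_sx$. $A=A_s+A_n$ is the Jordan–Chevalley decomposition ($A_s$ semisimple, $A_n$ nilpotent, commuting). $f$ is in Poincaré–Dulac normal form if $[A_s,f]=0$. *)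

(* Defs.v *)
From HB Require Import structures.
From mathcomp Require Import all_boot all_order all_algebra.
From mathcomp Require Import boolp reals.
From mathcomp Require Import mpoly.
From mathcomp.real_closed Require Import complex.

Set Implicit Arguments.
Unset Strict Implicit.
Unset Printing Implicit Defensive.

Import GRing.Theory.
Local Open Scope ring_scope.

(* K[[x_1, .., x_n]]: a series is its family of coefficients, indexed by the
   exponents 'X_{1..n}. *)
Record fps (K : Type) (n : nat) := FPS { fps_coef :> 'X_{1..n} -> K }.

Section FormalPowerSeries.
Variables (K : comNzRingType) (n : nat).
Implicit Types (a b c : fps K n) (m : 'X_{1..n}).

Lemma fpsP a b : (forall m, a m = b m) -> a = b.
Proof. by case: a => a; case: b => b /= eab; congr FPS; apply: funext. Qed.

HB.instance Definition _ := gen_eqMixin (fps K n).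
HB.instance Definition _ := gen_choiceMixin (fps K n).

Definition fps_zero : fps K n := FPS (fun=> 0).
Definition fps_opp a : fps K n := FPS (fun m => - a m).
Definition fps_add a b : fps K n := FPS (fun m => a m + b m).

Lemma fps_addA : associative fps_add.
Proof. by move=> a b c; apply: fpsP => m /=; rewrite addrA. Qed.
Lemma fps_addC : commutative fps_add.
Proof. by move=> a b; apply: fpsP => m /=; rewrite addrC. Qed.
Lemma fps_add0 : left_id fps_zero fps_add.
Proof. by move=> a; apply: fpsP => m /=; rewrite add0r. Qed.
Lemma fps_addN : left_inverse fps_zero fps_opp fps_add.
Proof. by move=> a; apply: fpsP => m /=; rewrite addNr. Qed.

HB.instance Definition _ :=
  GRing.isZmodule.Build (fps K n) fps_addA fps_addC fps_add0 fps_addN.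

Definition fps_one : fps K n := FPS (fun m => (m == 0%MM)%:R).

(* Cauchy product; the bound on the exponents only serves to make the set of
   pairs (k.1, k.2) with k.1 + k.2 = m a finite range. *)
Definition fps_mul a b : fps K n := FPS (fun m =>
  \sum_(k : 'X_{1..n < (mdeg m).+1, (mdeg m).+1} | m == (k.1 + k.2)%MM)
     a k.1 * b k.2).

Definition fps_trunc d a : {mpoly K[n]} := \sum_(m : 'X_{1..n < d}) a m *: 'X_[m].

Lemma fps_truncE d a m : (mdeg m < d)%N -> (fps_trunc d a)@_m = a m.
Proof. by move=> lt_md; rewrite /fps_trunc mcoeff_mpoly. Qed.

Lemma mcoeffM_low (p p' q q' : {mpoly K[n]}) d m : (mdeg m < d)%N ->
  (forall k, (mdeg k < d)%N -> p@_k = p'@_k) ->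
  (forall k, (mdeg k < d)%N -> q@_k = q'@_k) -> (p * q)@_m = (p' * q')@_m.
Proof.
move=> lt_md epp' eqq'; rewrite !mcoeffM; apply: eq_bigr => k /eqP mE.
have: (mdeg (bmnm k.1) + mdeg (bmnm k.2) < d)%N by rewrite -mdegD -mE.
by move=> lt_d; rewrite epp' ?eqq' // (leq_ltn_trans _ lt_d) ?leq_addr ?leq_addl.
Qed.

Lemma fps_mul_trunc d a b m : (mdeg m < d)%N ->
  fps_mul a b m = (fps_trunc d a * fps_trunc d b)@_m.
Proof.
move=> lt_md; rewrite (@mcoeffM_low _ (fps_trunc (mdeg m).+1 a) _
  (fps_trunc (mdeg m).+1 b) (mdeg m).+1) //.
- by rewrite mcoeffM; apply: eq_bigr => k _; rewrite !fps_truncE ?bmdeg.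
- by move=> k lt_k; rewrite !fps_truncE // (leq_trans lt_k).
- by move=> k lt_k; rewrite !fps_truncE // (leq_trans lt_k).
Qed.

Lemma fps_mulA : associative fps_mul.
Proof.
move=> a b c; apply: fpsP => m; have lt_m := ltnSn (mdeg m).
rewrite !(fps_mul_trunc _ _ lt_m).
set d := (mdeg m).+1; pose T := fps_trunc d.
transitivity ((T a * (T b * T c))@_m).
- by apply: (mcoeffM_low lt_m) => // k lt_k; rewrite fps_truncE // (fps_mul_trunc _ _ lt_k).
rewrite mulrA; symmetry; apply: (mcoeffM_low lt_m) => // k lt_k.
by rewrite fps_truncE // (fps_mul_trunc _ _ lt_k).
Qed.

Lemma fps_mulC : commutative fps_mul.
Proof.
move=> a b; apply: fpsP => m; have lt_m := ltnSn (mdeg m).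
by rewrite !(fps_mul_trunc _ _ lt_m) mulrC.
Qed.

Lemma fps_mul1 : left_id fps_one fps_mul.
Proof.
move=> a; apply: fpsP => m; have lt_m := ltnSn (mdeg m).
rewrite (fps_mul_trunc _ _ lt_m) -(fps_truncE a lt_m) -[in RHS](mul1r (fps_trunc _ a)).
apply: (mcoeffM_low lt_m) => // k lt_k.
by rewrite fps_truncE //= mcoeff1.
Qed.

Lemma fps_mulDl : left_distributive fps_mul fps_add.
Proof.
move=> a b c; apply: fpsP => m /=; rewrite -big_split /=.
by apply: eq_bigr => k _; rewrite mulrDl.
Qed.

Lemma fps_oner_neq0 : fps_one != 0.
Proof.
apply/eqP => /(congr1 (fun a : fps K n => a 0%MM)) /eqP /=.
by rewrite eqxx oner_eq0.
Qed.

HB.instance Definition _ := GRing.Zmodule_isComNzRing.Build (fps K n)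
  fps_mulA fps_mulC fps_mul1 fps_mulDl fps_oner_neq0.

Definition fps_unit : pred (fps K n) := fun a => `[< exists b, b * a = 1 >].

Definition fps_inv a : fps K n :=
  if pselect (exists b, b * a = 1) is left ex_b then sval (cid ex_b) else a.

Lemma fps_mulVr : {in fps_unit, left_inverse 1 fps_inv *%R}.
Proof.
move=> a /asboolP Ua; rewrite /fps_inv.
by case: pselect => // ex_b; case: cid.
Qed.

Lemma fps_unitPl a b : b * a = 1 -> fps_unit a.
Proof. by move=> ba1; apply/asboolP; exists b. Qed.

Lemma fps_invr_out : {in [predC fps_unit], fps_inv =1 id}.
Proof. by move=> a /asboolP nUa; rewrite /fps_inv; case: pselect. Qed.

HB.instance Definition _ := GRing.ComNzRing_hasMulInverse.Build (fps K n)
  fps_mulVr fps_unitPl fps_invr_out.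

Definition fpsC (x : K) : fps K n := FPS (fun m => if m == 0%MM then x else 0).

Definition fpsX (i : 'I_n) : fps K n := FPS (fun m => (m == U_(i)%MM)%:R).

Definition fps_homog (j : nat) a : fps K n :=
  FPS (fun m => if mdeg m == j then a m else 0).

Definition fps_deriv (i : 'I_n) a : fps K n :=
  FPS (fun m => a (m + U_(i))%MM *+ (m i).+1).

(* A formal vector field on K^n is a column of n series. *)

Definition jacobian (f : 'cV[fps K n]_n) : 'M[fps K n]_n :=
  \matrix_(i, j) fps_deriv j (f i 0).

(* Beware of the sign: [f, g] = Dg f - Df g. *)
Definition lie_bracket (f g : 'cV[fps K n]_n) : 'cV[fps K n]_n :=
  jacobian g *m f - jacobian f *m g.

Definition lie_derivative (f : 'cV[fps K n]_n) (phi : fps K n) : fps K n :=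
  \sum_(i < n) fps_deriv i phi * f i 0.

Definition linear_field (A : 'M[K]_n) : 'cV[fps K n]_n :=
  map_mx fpsC A *m \col_i fpsX i.

(* f = A + (terms of degree at least 2) *)
Definition has_linear_part (A : 'M[K]_n) (f : 'cV[fps K n]_n) : Prop :=
  map_mx (fps_homog 0) f = 0 /\ map_mx (fps_homog 1) f = linear_field A.

Definition poincare_dulac_normal_form (As : 'M[K]_n) (f : 'cV[fps K n]_n) :
  Prop := lie_bracket (linear_field As) f = 0.

End FormalPowerSeries.

(* Every invariant subspace has an invariant complement. As A acts on columns,
   x |-> A x, while subspaces are row spaces, stability is stated for A^T. *)
Definition semisimple_mx (K : fieldType) (n : nat) (A : 'M[K]_n) : Prop :=
  forall U : 'M[K]_n, stablemx U A^T ->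
  exists V : 'M[K]_n,
    [/\ stablemx V A^T, row_full (U + V)%MS & (U :&: V)%MS = 0].

Definition nilpotent_mx (K : fieldType) (n : nat) (A : 'M[K]_n) : Prop :=
  exists k : nat, A ^+ k = 0.

Definition jordan_chevalley (K : fieldType) (n : nat) (A As An : 'M[K]_n) :
  Prop :=
  [/\ A = As + An, semisimple_mx As, nilpotent_mx An & comm_mx As An].

Inductive real_or_complex : fieldType -> Prop :=
| is_real (R : realType) : real_or_complex R
| is_complex (R : realType) : real_or_complex R[i].

(* Main.v *)
(* Replacing g by sigma g changes lambda into lambda + X_f(sigma) / sigma, so
   one solves X_f(sigma) + lambda sigma = lambda* sigma degree by degree. In
   degree j the only unknown is X_A(u) with u homogeneous of degree j, and u can
   be chosen so that the new term of lambda* is killed by D = X_{A_s}: on the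
   finite-dimensional space of forms of degree j, D and the nilpotent X_{A_n}
   commute and ker D^2 = ker D, hence D X_A and D have the same kernel and so
   the same image.
   Then S = [A_s, .] - lambda_0 commutes with [f, .] - lambda*, which kills g*.
   If S g* starts in degree d, its leading part v is killed by
   S + [A_n, .]; as [A_n, .] is nilpotent and ker S^2 = ker S, this gives
   first S v = 0 and then v = 0.
   The equality ker S^2 = ker S is checked over an algebraically closed field,
   in linear coordinates which diagonalize A_s. *)

From HB Require Import structures.
Require Import Defs.
From mathcomp Require Import all_boot all_order all_algebra all_field.
From mathcomp Require Import boolp reals.
From mathcomp Require Import ring mpoly.
From mathcomp.real_closed Require Import complex.

Set Implicit Arguments.
Unset Strict Implicit.
Unset Printing Implicit Defensive.

Import GRing.Theory.
Local Open Scope ring_scope.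

(** * Semisimple matrices are diagonalizable over an algebraic closure *)

(** The kernel of N = q(A^T) has an invariant complement V. N maps V into V and, since N^2 = 0, also
    into ker N; so N vanishes on V, hence everywhere. *)
Lemma semisimple_horner_sqr0 (K : fieldType) n (A : 'M[K]_n.+1)
    (q : {poly K}) :
  semisimple_mx A -> horner_mx A^T (q * q) = 0 -> horner_mx A^T q = 0.
Proof.
move=> ssA; rewrite rmorphM /=; set N := horner_mx _ q => NN0.
have commN : comm_mx A^T N by apply: comm_mx_horner; apply: comm_mx_refl.
have [|V [stV fullV capV]] := ssA (kermx N).
  exact: comm_mx_stable_ker.
have VN0 : V *m N = 0.
  apply/eqP; rewrite -submx0 -capV sub_capmx horner_mx_stable // andbT.
  by apply/sub_kermxP; rewrite -mulmxA [N *m N]NN0 mulmx0.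
have : (kermx N + V <= kermx N)%MS.
  by rewrite addsmx_sub submx_refl; apply/sub_kermxP.
move=> /(submx_trans (submx_full 1%:M fullV)) /sub_kermxP.
by rewrite mul1mx.
Qed.

Lemma deriv_pchar0_neq0 (K : fieldType) (p : {poly K}) :
  [pchar K] =i pred0 -> (1 < size p)%N -> p^`() != 0.
Proof.
move=> /pcharf0P char0; case szp: (size p) => [|[|k]] // _.
apply/eqP => /(congr1 (fun q : {poly K} => q`_k)) /eqP.
rewrite coef_deriv coef0 -mulr_natr mulf_eq0 char0 orbF.
have -> : k.+1 = (size p).-1 by rewrite szp.
by rewrite -lead_coefE lead_coef_eq0 -size_poly_eq0 szp.
Qed.

(** If the minimal polynomial is p = h u^2, then (h u)^2 = p h annihilates A^T, hence so does h u,
    whose degree is too small unless u is constant. In characteristic 0 square-free implies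
    separable. *)
Lemma semisimple_separable (K : fieldType) n (A : 'M[K]_n.+1) :
  [pchar K] =i pred0 -> semisimple_mx A -> separable_poly (mxminpoly A^T).
Proof.
move=> char0 ssA; set p := mxminpoly _.
have p_neq0 : p != 0 by rewrite monic_neq0 // mxminpoly_monic.
apply/separable_polyP; split; last by move=> u _; apply: deriv_pchar0_neq0.
apply/poly_square_freeP => u szu; apply/negP => /dvdpP[h pE].
have /mxminpoly_minP : horner_mx A^T (h * u) = 0.
  apply: (semisimple_horner_sqr0 ssA).
  have ->: h * u * (h * u) = p * h by rewrite pE expr2; ring.
  by rewrite rmorphM /= mx_root_minpoly mul0r.
have hu_neq0 : h * u != 0.
  by apply: contra_neq p_neq0; rewrite pE expr2 mulrA => ->; rewrite mul0r.
rewrite -/p pE expr2 mulrA => /dvdp_leq => /(_ hu_neq0).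
rewrite size_mul //; last by apply: contra_neq hu_neq0 => ->; rewrite mulr0.
have u_neq0 : u != 0 by apply: contra_neq hu_neq0 => ->; rewrite mulr0.
move: szu; rewrite -size_poly_gt0 in u_neq0 hu_neq0.
case: (size u) u_neq0 => [|[|k]] // _ _.
by rewrite addnS /= addnS leqNgt ltnS leq_addr.
Qed.

(** The minimal polynomial is carried over by [iota] and stays separable, so over C it is a product
    of distinct linear factors. *)
Lemma semisimple_diagonalizable (K : fieldType) (C : closedFieldType)
    (iota : {rmorphism K -> C}) n (A : 'M[K]_n) :
  [pchar K] =i pred0 -> semisimple_mx A ->
  exists (P : 'M[C]_n) (d : 'rV[C]_n),
    P \in unitmx /\ P *m map_mx iota A = diag_mx d *m P.
Proof.
case: n A => [|n] A char0 ssA.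
  by exists 1%:M, 0; rewrite unitmx1; split=> //; apply/matrixP => -[].
have := semisimple_separable char0 ssA.
rewrite -(separable_map iota) -mxminpoly_map.
set B := map_mx _ _; set p := mxminpoly B.
have [rs pE] := closed_field_poly_normal p.
rewrite (monicP (mxminpoly_monic _)) scale1r in pE.
rewrite pE separable_prod_XsubC => uniq_rs.
have /diagonalizableP[P Pu /(diagonalizable_forLR Pu)[d BE]] :
    exists2 rs, uniq rs & p %| \prod_(x <- rs) ('X - x%:P).
  by exists rs => //; rewrite -pE.
(* Stability concerns A^T, so it is the transpose [B] that equals P^-1 D P; transposing back makes
   the inverse of P^T the new coordinates. *)
exists (invmx P^T), d; rewrite unitmx_inv unitmx_tr; split=> //.
have -> : map_mx iota A = B^T by rewrite /B map_trmx trmxK.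
rewrite BE mxpoly.conjVmx // !trmx_mul tr_diag_mx trmx_inv.
by rewrite mulKmx ?unitmx_tr.
Qed.

Lemma real_or_complex_closure (K : fieldType) : real_or_complex K ->
  [pchar K] =i pred0 /\
  exists (C : closedFieldType) (iota : {rmorphism K -> C}), True.
Proof.
case=> R; split; try exact: Num.Theory.pchar_num.
  by exists R[i], (real_complex R).
by exists R[i], idfun.
Qed.

(** * Linear vector fields acting on polynomials *)

(** Constants and variables generate the algebra, so identities between derivations or substitutions
    reduce to linear forms. *)
Lemma mpoly_alg_ind (R : comNzRingType) n (P : {mpoly R[n]} -> Prop) :
  (forall c, P c%:MP) -> (forall i, P 'X_i) ->
  (forall p q, P p -> P q -> P (p + q)) ->
  (forall p q, P p -> P q -> P (p * q)) -> forall p, P p.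
Proof.
move=> PC PX PD PM; elim/mpolyind => [|c m p _ _ Pp].
  by rewrite -mpolyC0; apply: (PC).
apply: (PD) => //; rewrite -mul_mpolyC; apply: (PM) => //.
rewrite mpolyXE_id; elim/big_rec: _ => [|i q _ Pq].
  by rewrite -mpolyC1; apply: (PC).
apply: (PM) => //; elim: (m i) => [|k IHk]; last by rewrite exprS; apply: (PM).
by rewrite expr0 -mpolyC1; apply: (PC).
Qed.

Section LinearDerivation.
Variables (R : comNzRingType) (n : nat).
Implicit Types (A P : 'M[R]_n) (d : 'rV[R]_n) (p q : {mpoly R[n]}).

Definition linform A (i : 'I_n) : {mpoly R[n]} := \sum_j A i j *: 'X_j.

Definition mlinder A p : {mpoly R[n]} := \sum_i p^`M(i) * linform A i.

Lemma mlinder_is_linear A : linear (mlinder A).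
Proof.
move=> c p q; rewrite /mlinder scaler_sumr -big_split /=; apply: eq_bigr => i _.
by rewrite linearP /= mulrDl scalerAl.
Qed.
HB.instance Definition _ A :=
  GRing.isLinear.Build R {mpoly R[n]} {mpoly R[n]} _ (mlinder A)
    (mlinder_is_linear A).

Lemma mlinderM A p q : mlinder A (p * q) = mlinder A p * q + p * mlinder A q.
Proof.
rewrite /mlinder mulr_suml mulr_sumr -big_split /=; apply: eq_bigr => i _.
by rewrite mderivM; ring.
Qed.

Lemma mlinderC A c : mlinder A c%:MP = 0.
Proof. by rewrite /mlinder big1 // => i _; rewrite mderivC mul0r. Qed.

Lemma mderivXU i j : 'X_j^`M(i) = (i == j)%:R :> {mpoly R[n]}.
Proof.
rewrite mderivX mnm1E eq_sym; case: eqVneq => [->|_]; last by rewrite scale0r.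
rewrite scale1r; have -> : (U_(j) - U_(j) = 0)%MM; last by rewrite mpolyX0.
by apply/mnmP => k; rewrite mnmBE subnn mnm0E.
Qed.

Lemma mlinderX A i : mlinder A 'X_i = linform A i.
Proof.
rewrite /mlinder (bigD1 i) //= mderivXU eqxx mul1r big1 ?addr0 // => j ji.
by rewrite mderivXU (negPf ji) mul0r.
Qed.

(** When P A = D P with D diagonal, this makes the rows of P eigenfunctions of the field A. *)
Lemma mlinder_linform A P i : mlinder A (linform P i) = linform (P *m A) i.
Proof.
rewrite /linform linear_sum /=.
under eq_bigr do rewrite linearZ /= mlinderX scaler_sumr.
rewrite exchange_big /=; apply: eq_bigr => k _; rewrite mxE scaler_suml.
by apply: eq_bigr => j _; rewrite scalerA.
Qed.

Lemma linform_diag d P i : linform (diag_mx d *m P) i = d 0 i *: linform P i.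
Proof.
rewrite /linform scaler_sumr; apply: eq_bigr => j _.
by rewrite mul_diag_mx mxE scalerA.
Qed.

Lemma linform1 i : linform 1%:M i = 'X_i.
Proof.
rewrite /linform (bigD1 i) //= mxE eqxx scale1r big1 ?addr0 // => j ji.
by rewrite mxE eq_sym (negPf ji) scale0r.
Qed.

(** Monomials are eigenvectors of a diagonal field, because x_i d/dx_i multiplies x^m by m_i. *)
Lemma mcoeff_mlinder_diag d p m :
  (mlinder (diag_mx d) p)@_m = (\sum_i d 0 i *+ m i) * p@_m.
Proof.
elim/mpolyind: p => [|c k p _ _ IHp]; first by rewrite linear0 !mcoeff0 mulr0.
rewrite linearP /= !mcoeffD IHp mulrDr; congr (_ + _).
rewrite !mcoeffZ mulrCA; congr (c * _).
transitivity ((\sum_i d 0 i *+ k i) * 'X_[k]@_m); last first.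
  rewrite mcoeffX; case: eqVneq => [->|_] //; by rewrite !mulr0.
rewrite -mcoeffZ; congr (_@_m); rewrite /mlinder scaler_suml.
apply: eq_bigr => i _; rewrite -[diag_mx d]mulmx1 linform_diag linform1.
rewrite mderivX -scalerAr -scalerAl scalerA mulr_natr -mpolyXD.
(* Subtraction of exponents truncates at exponent 0, but there the coefficient vanishes. *)
case: (posnP (k i)) => [->|ki]; first by rewrite !mulr0n !scale0r.
congr (_ *: 'X_[_]); apply/mnmP => j; rewrite mnmDE mnmBE mnm1E.
by case: eqVneq => [<-|_]; rewrite ?subnK ?subn0 ?addn0.
Qed.

Definition linsubst P p : {mpoly R[n]} := p \mPo [tuple linform P i | i < n].

Lemma linsubst_is_linear P : linear (linsubst P).
Proof. by move=> c p q; rewrite /linsubst linearP. Qed.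
HB.instance Definition _ P :=
  GRing.isLinear.Build R {mpoly R[n]} {mpoly R[n]} _ (linsubst P)
    (linsubst_is_linear P).

Lemma linsubstM P p q : linsubst P (p * q) = linsubst P p * linsubst P q.
Proof. by rewrite /linsubst rmorphM. Qed.

Lemma linsubstC P c : linsubst P c%:MP = c%:MP.
Proof. by rewrite /linsubst comp_mpolyC. Qed.

Lemma linsubstX P i : linsubst P 'X_i = linform P i.
Proof. by rewrite /linsubst comp_mpolyXU -tnth_nth tnth_mktuple. Qed.

Lemma linsubst_linform P Q i : linsubst P (linform Q i) = linform (Q *m P) i.
Proof.
rewrite /linform linear_sum /=.
under eq_bigr do rewrite linearZ /= linsubstX scaler_sumr.
rewrite exchange_big /=; apply: eq_bigr => k _; rewrite mxE scaler_suml.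
by apply: eq_bigr => j _; rewrite scalerA.
Qed.

Lemma linsubstK P Q : Q *m P = 1%:M -> cancel (linsubst Q) (linsubst P).
Proof.
move=> QP1; apply: mpoly_alg_ind => [c|i|p q IHp IHq|p q IHp IHq].
- by rewrite !linsubstC.
- by rewrite linsubstX linsubst_linform QP1 linform1.
- by rewrite !linearD /= IHp IHq.
- by rewrite !linsubstM IHp IHq.
Qed.

(** Both sides obey the same product rule along the substitution, so only the variables matter,
    where the claim is P A = D P. *)
Lemma mlinder_linsubst A P d p : P *m A = diag_mx d *m P ->
  mlinder A (linsubst P p) = linsubst P (mlinder (diag_mx d) p).
Proof.
move=> PA; elim/mpoly_alg_ind: p => [c|i|p q IHp IHq|p q IHp IHq].
- by rewrite linsubstC !mlinderC linear0.
- by rewrite linsubstX mlinder_linform PA mlinderX linsubst_linform.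
- by rewrite !linearD /= IHp IHq.
- by rewrite linsubstM !mlinderM linearD /= !linsubstM IHp IHq.
Qed.

End LinearDerivation.

(* In the coordinates given by the rows of P, [mlinder A] multiplies each
   monomial by a scalar. *)
Lemma mlinder_diag_ker2 (C : fieldType) n (A P : 'M[C]_n) d c p :
    P \in unitmx -> P *m A = diag_mx d *m P ->
    let D := fun q : {mpoly C[n]} => mlinder A q - c *: q in
  D (D p) = 0 -> D p = 0.
Proof.
move=> Pu PA D; pose E q := mlinder (diag_mx d) q - c *: q.
have DE q : D (linsubst P q) = linsubst P (E q).
  rewrite /D /E (linearB (linsubst P)) /= [linsubst P (c *: _)]linearZ.
  by rewrite (mlinder_linsubst _ PA).
have PK : cancel (linsubst (invmx P)) (linsubst P).
  by apply: linsubstK; rewrite mulVmx.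
have KP : cancel (linsubst P) (linsubst (invmx P)).
  by apply: linsubstK; rewrite mulmxV.
rewrite -[p]PK !DE => /(congr1 (linsubst (invmx P))); rewrite KP linear0.
set q := linsubst _ p => EE0; suff -> : E q = 0 by rewrite linear0.
have mcE r m : (E r)@_m = (\sum_i d 0 i *+ m i - c) * r@_m.
  by rewrite mcoeffB mcoeffZ mcoeff_mlinder_diag mulrBl.
apply/mpolyP => m; move/(congr1 (mcoeff m)): EE0.
rewrite !mcE !mcoeff0 => /eqP; rewrite mulf_eq0 => /orP[/eqP->|/eqP //].
by rewrite mul0r.
Qed.

(** * Extension of scalars *)

Section ScalarExtension.
Variables (K C : fieldType) (iota : {rmorphism K -> C}) (n : nat).
Implicit Types (A : 'M[K]_n) (p : {mpoly K[n]}).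

Lemma map_mpoly_inj : injective (map_mpoly iota : {mpoly K[n]} -> _).
Proof.
move=> p q /mpolyP epq; apply/mpolyP => m.
by have := epq m; rewrite !mcoeff_map_mpoly => /fmorph_inj.
Qed.

Lemma map_mpoly_mlinder A p :
  map_mpoly iota (mlinder A p) = mlinder (map_mx iota A) (map_mpoly iota p).
Proof.
rewrite /mlinder rmorph_sum; apply: eq_bigr => i _.
rewrite rmorphM; congr (_ * _).
  apply/mpolyP => m.
  by rewrite mcoeff_map_mpoly !mcoeff_deriv mcoeff_map_mpoly raddfMn.
rewrite /linform raddf_sum; apply: eq_bigr => j _.
apply/mpolyP => m; rewrite mcoeff_map_mpoly !mcoeffZ !mcoeffX mxE.
by rewrite [LHS]rmorphM rmorph_nat.
Qed.

End ScalarExtension.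

(* [A, v] - c v for a polynomial vector field v *)
Definition mpoly_lie (K : comNzRingType) n (A : 'M[K]_n) c
    (v : 'cV[{mpoly K[n]}]_n) :=
  map_mx (mlinder A) v - map_mx (@mpolyC n K) A *m v - c%:MP *: v.

(** * Kernels of squares for a semisimple linear field *)

Section SemisimpleKernel.
Variables (K : fieldType) (n : nat) (A : 'M[K]_n).
Hypotheses (hK : real_or_complex K) (ssA : semisimple_mx A).

Lemma semisimple_mlinder_ker2 p :
  mlinder A (mlinder A p) = 0 -> mlinder A p = 0.
Proof.
have [char0 [C [iota _]]] := real_or_complex_closure hK.
have [P [d [Pu PA]]] := semisimple_diagonalizable iota char0 ssA.
move=> DD0; apply: (@map_mpoly_inj _ _ iota); rewrite map_mpoly_mlinder raddf0.
have := @mlinder_diag_ker2 _ _ _ _ _ 0 (map_mpoly iota p) Pu PA.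
by rewrite /= !scale0r !subr0 -!map_mpoly_mlinder DD0 raddf0; apply.
Qed.

(** Passing to the components of P v over C diagonalizes the matrix term of the bracket: component i
    is acted on by X_A - (d_i + c), and [mlinder_diag_ker2] applies to each one. *)
Lemma semisimple_mpoly_lie_ker2 c v :
  mpoly_lie A c (mpoly_lie A c v) = 0 -> mpoly_lie A c v = 0.
Proof.
have [char0 [C [iota _]]] := real_or_complex_closure hK.
have [P [d [Pu PA]]] := semisimple_diagonalizable iota char0 ssA.
set S := mpoly_lie A c; pose mC := @mpolyC n C.
pose W (u : 'cV[{mpoly K[n]}]_n) := map_mx mC P *m map_mx (map_mpoly iota) u.
have W_inj u : W u = 0 -> u = 0.
  move=> /(congr1 (mulmx (map_mx mC (invmx P)))).
  rewrite mulmxA -map_mxM /= mulVmx // map_mx1 mul1mx mulmx0 => /matrixP u0.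
  apply/matrixP => i j; apply: (@map_mpoly_inj _ _ iota).
  by have := u0 i j; rewrite !mxE => ->; rewrite raddf0.
have WB u1 u2 : W (u1 - u2) = W u1 - W u2.
  rewrite /W -mulmxBr; congr (_ *m _); apply/matrixP => k l.
  by rewrite !mxE [LHS]raddfB.
have WS u i : W (S u) i 0 =
    mlinder (map_mx iota A) (W u i 0) - (d 0 i + iota c) *: W u i 0.
  have E1 : W (map_mx (mlinder A) u) = map_mx (mlinder (map_mx iota A)) (W u).
    apply/matrixP => k l; rewrite !mxE linear_sum /=; apply: eq_bigr => j _.
    by rewrite !mxE map_mpoly_mlinder !mul_mpolyC linearZ.
  have E2 : W (map_mx (@mpolyC n K) A *m u) = map_mx mC (diag_mx d) *m W u.
    rewrite /W [RHS]mulmxA -map_mxM -PA 2!map_mxM -mulmxA.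
    congr (_ *m (_ *m _)); apply/matrixP => k l.
    by rewrite !mxE; apply: map_mpolyC.
  have E3 : W (c%:MP *: u) = (iota c)%:MP *: W u.
    rewrite /W scalemxAr; congr (_ *m _); apply/matrixP => k l.
    by rewrite !mxE [LHS]rmorphM /= map_mpolyC.
  rewrite /S /mpoly_lie 2!WB E1 E2 E3.
  rewrite map_diag_mx mul_diag_mx scalerDl opprD addrA !mxE.
  by rewrite !mul_mpolyC.
move=> SS0; apply: W_inj; apply/colP => i; rewrite WS [RHS]mxE.
apply: (mlinder_diag_ker2 Pu PA); rewrite -!WS SS0.
by rewrite /W map_mx0 mulmx0 mxE.
Qed.

End SemisimpleKernel.

(** * The nilpotent part and the homological equation *)

(** Induction on k: N v is again killed by S + N and needs one iteration less, so S N v = 0. Then S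
    v = - N v gives S^2 v = 0. *)
Lemma nilpotent_add_ker (V : zmodType) (S N : {additive V -> V}) :
  (forall v, S (N v) = N (S v)) -> (forall v, S (S v) = 0 -> S v = 0) ->
  forall k v, iter k N v = 0 -> S v + N v = 0 -> S v = 0.
Proof.
move=> SN kerS; elim=> [|k IHk] v; first by move=> /= -> _; rewrite raddf0.
rewrite iterSr => Nv0 SNv0.
have SNv : S (N v) = 0 by apply: IHk => //; rewrite SN -raddfD SNv0 raddf0.
apply: kerS; move/eqP: SNv0; rewrite addr_eq0 => /eqP ->.
by rewrite raddfN SNv oppr0.
Qed.

Lemma iter_raddf0 (V : zmodType) (N : {additive V -> V}) k : iter k N 0 = 0.
Proof. by elim: k => // k IHk; rewrite iterS IHk raddf0. Qed.

Lemma iter_raddfD (V : zmodType) (N : {additive V -> V}) k u v :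
  iter k N (u + v) = iter k N u + iter k N v.
Proof. by elim: k => // k IHk; rewrite !iterS IHk raddfD. Qed.

Lemma iter_raddf0_le (V : zmodType) (N : {additive V -> V}) k l v :
  (k <= l)%N -> iter k N v = 0 -> iter l N v = 0.
Proof. by move=> /subnK <- Nv0; rewrite iterD Nv0 iter_raddf0. Qed.

(** Each application of N spends one of the remaining k derivatives of a or one of the remaining l
    of v, whence an induction on k + l in place of a binomial expansion. *)
Lemma iter_leibniz0 (R : comNzRingType) (V : lmodType R)
    (D : {additive R -> R}) (N : {additive V -> V}) :
    (forall a v, N (a *: v) = D a *: v + a *: N v) ->
  forall k l a v, iter k D a = 0 -> iter l N v = 0 ->
  iter (k + l) N (a *: v) = 0.
Proof.
move=> leibniz k l; have [s sE] := ubnP (k + l).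
elim: s => // s IHs in k l sE *.
case: k sE => [|k] sE a v; first by move=> /= -> _; rewrite scale0r iter_raddf0.
case: l sE => [|l] sE.
  by move=> _ /= v0; rewrite v0 scaler0 iter_raddf0 raddf0.
move=> Da Nv; rewrite addSn iterSr leibniz iter_raddfD.
rewrite ltnS addSn in sE; have sE' : (k.+1 + l < s)%N by rewrite addSnnS.
rewrite (IHs _ _ sE) ?add0r -?iterSr // -addSnnS.
by rewrite (IHs _ _ sE') // -iterSr.
Qed.

(** Rank-nullity: ker (f g) lies in ker f, so f g has at least the rank of f, while its image lies
    in that of f. *)
Lemma sub_ker_limg (K : fieldType) (V W : vectType K) (f : 'Hom(V, W))
    (g : 'End(V)) :
  (forall v, f (g v) = 0 -> f v = 0) -> forall w, exists u, f (g u) = f w.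
Proof.
move=> kerfg w.
have ker_le : (lker (f \o g) <= lker f)%VS.
  by apply/subvP => v; rewrite !memv_ker comp_lfunE /= => /eqP/kerfg ->.
have img_le : (limg (f \o g) <= limg f)%VS.
  by rewrite limg_comp limgS // subvf.
have imgE : limg (f \o g) = limg f.
  apply/eqP; rewrite eqEdim img_le /=.
  rewrite -(leq_add2l (\dim (lker f))) -{1}[lker f]capfv limg_ker_dim.
  by rewrite -(limg_ker_dim (f \o g)) capfv leq_add2r dimvS.
have: f w \in limg (f \o g) by rewrite imgE memv_img // memvf.
by case/memv_imgP => u _ ->; exists u; rewrite comp_lfunE.
Qed.

Section LinearDerivationMore.
Variables (R : comNzRingType) (n : nat).
Implicit Types (A B : 'M[R]_n) (p q : {mpoly R[n]}) (v w : 'cV[{mpoly R[n]}]_n).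

Lemma mlinderD A B p : mlinder (A + B) p = mlinder A p + mlinder B p.
Proof.
rewrite /mlinder -big_split /=; apply: eq_bigr => i _; rewrite -mulrDr.
rewrite /linform -big_split /=; congr (_ * _); apply: eq_bigr => j _.
by rewrite mxE scalerDl.
Qed.

(** The commutator of two derivations is a derivation; on the variables it vanishes because A B = B
    A. *)
Lemma mlinder_comm A B p : comm_mx A B ->
  mlinder A (mlinder B p) = mlinder B (mlinder A p).
Proof.
move=> AB; elim/mpoly_alg_ind: p => [c|i|p q IHp IHq|p q IHp IHq].
- by rewrite !mlinderC ?linear0.
- by rewrite !mlinderX !mlinder_linform AB.
- by rewrite !linearD /= IHp IHq.
- by rewrite !mlinderM !linearD /= !mlinderM IHp IHq; ring.
Qed.

Lemma mlinder_homog A d p : p \is d.-homog -> mlinder A p \is d.-homog.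
Proof.
move=> /dhomogP hp; apply: rpred_sum => i _.
case: d hp => [|d] hp.
  have -> : p^`M(i) = 0.
    apply/mpolyP => m; rewrite mcoeff_deriv mcoeff0 memN_msupp_eq0 ?mul0rn //.
    by apply/negP => /hp /=; rewrite mdegD mdeg1 addn1.
  by rewrite mul0r rpred0.
rewrite -addn1; apply: dhomogM.
  apply/dhomogP => m; rewrite mcoeff_msupp mcoeff_deriv => nz.
  have /hp /= : (m + U_(i))%MM \in msupp p.
    by rewrite mcoeff_msupp; apply: contraNneq nz => ->; rewrite mul0rn.
  by rewrite mdegD mdeg1 addn1 => -[].
by apply: rpred_sum => j _; apply: rpredZ; rewrite dhomogX /= mdeg1.
Qed.

Lemma iter_mlinder_linform A k i :
  iter k (mlinder A) 'X_i = linform (A ^+ k) i.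
Proof.
elim: k => [|k IHk]; first by rewrite /= linform1.
by rewrite iterS IHk mlinder_linform exprSr.
Qed.

(** Nilpotency is only local: k depends on p. On variables the powers of A appear, and the Leibniz
    rule handles products. *)
Lemma mlinder_nilpotent A p : (exists k, A ^+ k = 0) ->
  exists k, iter k (mlinder A) p = 0.
Proof.
case=> r Ar0.
elim/mpoly_alg_ind: p => [c|i|p q [k kp] [l lq]|p q [k kp] [l lq]].
- by exists 1; rewrite /= mlinderC.
- exists r; rewrite iter_mlinder_linform Ar0 /linform big1 // => j _.
  by rewrite mxE scale0r.
- exists (maxn k l); rewrite iter_raddfD.
  rewrite (@iter_raddf0_le _ _ _ (maxn k l) _ _ kp) ?leq_maxl //.
  by rewrite add0r (@iter_raddf0_le _ _ _ (maxn k l) _ _ lq) ?leq_maxr.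
- exists (k + l)%N.
  (* The polynomial ring is viewed as a module over itself, so that scaling is the product. *)
  exact: (@iter_leibniz0 _ {mpoly R[n]}^o (mlinder A) (mlinder A)
            (fun a b => mlinderM A a b) k l p q kp lq).
Qed.

Lemma mpoly_lie_is_additive A c : additive (mpoly_lie A c).
Proof.
move=> v w; rewrite /mpoly_lie raddfB /= mulmxBr scalerBr.
by apply/colP => i; rewrite !mxE; ring.
Qed.
HB.instance Definition _ A c :=
  GRing.isAdditive.Build _ _ (mpoly_lie A c) (mpoly_lie_is_additive A c).

Lemma mpoly_lie_leibniz A p v :
  mpoly_lie A 0 (p *: v) = mlinder A p *: v + p *: mpoly_lie A 0 v.
Proof.
rewrite /mpoly_lie !scale0r !subr0 scalerBr -scalemxAr addrA; congr (_ - _).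
by apply/colP => i; rewrite !mxE mlinderM.
Qed.

Lemma mpoly_lie_const A (e : 'cV[R]_n) :
  mpoly_lie A 0 (map_mx (@mpolyC n R) e) = map_mx (@mpolyC n R) (- (A *m e)).
Proof.
rewrite /mpoly_lie scale0r subr0 -map_mxM map_mxN /=.
rewrite -[RHS]add0r; congr (_ - _).
by apply/colP => i; rewrite !mxE mlinderC.
Qed.

(** On constant fields the bracket is e |-> - A e, which is nilpotent. Any v is a combination of
    constant fields with polynomial coefficients, on which X_A is locally nilpotent. *)
Lemma mpoly_lie_nilpotent A v : (exists k, A ^+ k = 0) ->
  exists k, iter k (mpoly_lie A 0) v = 0.
Proof.
move=> Anil; have [r Ar0] := Anil.
have iter_const k e : iter k (mpoly_lie A 0) (map_mx (@mpolyC n R) e)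
    = map_mx (@mpolyC n R) ((-1) ^+ k *: (A ^+ k *m e)).
  elim: k => [|k IHk]; first by rewrite scale1r mul1mx.
  rewrite iterS IHk mpoly_lie_const -scalemxAr mulmxA -[A *m _]exprS.
  by rewrite -scaleNr [(-1) ^+ k.+1]exprS mulN1r.
have -> : v = \sum_i v i 0 *: map_mx (@mpolyC n R) (delta_mx i 0).
  rewrite {1}[v]matrix_sum_delta; apply: eq_bigr => i _.
  by rewrite big_ord1 map_delta_mx.
elim/big_ind: _ => [|u w [k ku] [l lw]|i _].
- by exists 0.
- exists (maxn k l); rewrite iter_raddfD.
  rewrite (@iter_raddf0_le _ _ _ (maxn k l) _ _ ku) ?leq_maxl //.
  by rewrite add0r (@iter_raddf0_le _ _ _ (maxn k l) _ _ lw) ?leq_maxr.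
- have [k kv] := mlinder_nilpotent (v i 0) Anil.
  exists (k + r)%N.
  apply: (@iter_leibniz0 _ _ (mlinder A) (mpoly_lie A 0)) => //.
    exact: mpoly_lie_leibniz.
  by rewrite iter_const Ar0 mul0mx scaler0 map_mx0.
Qed.

Lemma mlinder_const_mulmx A B v :
  map_mx (mlinder A) (map_mx (@mpolyC n R) B *m v) =
  map_mx (@mpolyC n R) B *m map_mx (mlinder A) v.
Proof.
apply/colP => i; rewrite !mxE linear_sum /=; apply: eq_bigr => j _.
by rewrite !mxE !mul_mpolyC linearZ.
Qed.

Lemma mpoly_lie_comm A B c v : comm_mx A B ->
  mpoly_lie A c (mpoly_lie B 0 v) = mpoly_lie B 0 (mpoly_lie A c v).
Proof.
move=> AB; pose D C (w : 'cV[{mpoly R[n]}]_n) := map_mx (mlinder C) w.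
pose M (C : 'M[R]_n) (w : 'cV[{mpoly R[n]}]_n) := map_mx (@mpolyC n R) C *m w.
have DB C w1 w2 : D C (w1 - w2) = D C w1 - D C w2.
  by apply/colP => i; rewrite !mxE linearB.
have DZ C w : D C (c%:MP *: w) = c%:MP *: D C w.
  by apply/colP => i; rewrite !mxE !mul_mpolyC linearZ.
have MB C w1 w2 : M C (w1 - w2) = M C w1 - M C w2 by exact: mulmxBr.
have MZ C w : M C (c%:MP *: w) = c%:MP *: M C w by rewrite /M scalemxAr.
have DM C E w : D C (M E w) = M E (D C w) by exact: mlinder_const_mulmx.
have DD w : D A (D B w) = D B (D A w).
  by apply/colP => i; rewrite !mxE mlinder_comm.
have MM w : M A (M B w) = M B (M A w).
  by rewrite /M !mulmxA -!map_mxM AB.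
have lieE C e w : mpoly_lie C e w = D C w - M C w - e%:MP *: w by [].
rewrite !lieE {lieE}.
(* Forgetting what D and M stand for keeps unification from unfolding them. *)
move: D M DB DZ MB MZ DM DD MM => D M DB DZ MB MZ DM DD MM.
rewrite !scale0r !subr0 !(DB, MB, DZ, MZ, DM) DD MM scalerBr.
by apply/colP => i; rewrite !mxE; ring.
Qed.

Lemma mpoly_lieD A B c v :
  mpoly_lie (A + B) c v = mpoly_lie A c v + mpoly_lie B 0 v.
Proof.
rewrite /mpoly_lie.
have -> : map_mx (@mpolyC n R) (A + B) =
    map_mx (@mpolyC n R) A + map_mx (@mpolyC n R) B.
  by apply/matrixP => i j; rewrite !mxE mpolyCD.
rewrite mulmxDl scale0r.
by apply/colP => i; rewrite !mxE mlinderD; ring.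
Qed.

End LinearDerivationMore.

(** The restriction to forms of degree d gives a finite-dimensional space on which dimensions can be
    counted. *)
Definition dhomog_mlinder (R : comNzRingType) n (A : 'M[R]_n) d
    (p : dhomog n R d) : dhomog n R d :=
  DHomog (mlinder_homog A (dhomog_is_dhomog p)).

Lemma dhomog_mlinder_is_linear (R : comNzRingType) n (A : 'M[R]_n) d :
  linear (@dhomog_mlinder R n A d).
Proof. by move=> c p q; apply: val_inj; rewrite /= linearP. Qed.
HB.instance Definition _ (R : comNzRingType) n (A : 'M[R]_n) d :=
  GRing.isLinear.Build R (dhomog n R d) (dhomog n R d) _
    (@dhomog_mlinder R n A d) (@dhomog_mlinder_is_linear R n A d).

(** * Passing between A and its semisimple part *)

Section JordanChevalley.
Variables (K : fieldType) (n : nat) (A As An : 'M[K]_n).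
Hypotheses (hK : real_or_complex K) (hA : jordan_chevalley A As An).

(** [nilpotent_add_ker] is applied to q = X_{A_s} p: commutation gives (X_{A_s} + X_{A_n}) q = 0,
    hence X_{A_s} q = 0, and then q = 0. *)
Lemma jordan_mlinder_ker p :
  mlinder As (mlinder A p) = 0 -> mlinder As p = 0.
Proof.
have [-> ssA nilA comA] := hA => DA0.
apply: semisimple_mlinder_ker2 => //.
have [k Nk] := mlinder_nilpotent (mlinder As p) nilA.
apply: (@nilpotent_add_ker _ (mlinder As) (mlinder An) _ _ k) => //.
- by move=> q; apply: mlinder_comm.
- exact: semisimple_mlinder_ker2.
by rewrite -mlinderD mlinder_comm // /comm_mx mulmxDl mulmxDr comA.
Qed.

Lemma jordan_mpoly_lie_ker c v :
  mpoly_lie A c v = 0 -> mpoly_lie As c v = 0.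
Proof.
have [-> ssA nilA comA] := hA; rewrite mpoly_lieD => SN0.
have [k Nk] := mpoly_lie_nilpotent v nilA.
exact: (@nilpotent_add_ker _ (mpoly_lie As c) (mpoly_lie An 0)
  (fun w => mpoly_lie_comm c w comA)
  (fun w => @semisimple_mpoly_lie_ker2 _ _ _ hK ssA c w) k v Nk SN0).
Qed.

(** On forms of degree d, X_{A_s} X_A has the same image as X_{A_s}, by [jordan_mlinder_ker]. So
    X_{A_s} w has a preimage under it, and u is its opposite. *)
Lemma jordan_mlinder_solve d (w : {mpoly K[n]}) : w \is d.-homog ->
  exists2 u, u \is d.-homog & mlinder As (w + mlinder A u) = 0.
Proof.
move=> hw; case: n A As jordan_mlinder_ker w hw => [|m] B Bs kerB w hw.
  (* Without variables every derivation is an empty sum. *)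
  by exists 0; rewrite ?rpred0 // /mlinder big_ord0.
pose f : 'End(dhomog m.+1 K d) := linfun (dhomog_mlinder Bs (d:=d)).
pose g : 'End(dhomog m.+1 K d) := linfun (dhomog_mlinder B (d:=d)).
have [v|u fgu] := @sub_ker_limg _ _ _ f g _ (DHomog hw).
  rewrite !lfunE => /(congr1 val) /= /kerB Dv0.
  exact: val_inj.
exists (- val u); first by rewrite rpredN; apply: dhomog_is_dhomog.
move: fgu; rewrite !lfunE => /(congr1 val) /= fgu.
by rewrite linearN linearD linearN /= fgu subrr.
Qed.

End JordanChevalley.

(** * Formal power series and the Lie bracket *)

Section FormalSeriesOrder.
Variables (K : comNzRingType) (n : nat).
Implicit Types (a b c : fps K n) (m : 'X_{1..n}) (d e : nat).

Lemma fps_coefD a b m : (a + b) m = a m + b m. Proof. by []. Qed.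
Lemma fps_coefN a m : (- a) m = - a m. Proof. by []. Qed.
Lemma fps_coef1 m : (1 : fps K n) m = (m == 0%MM)%:R. Proof. by []. Qed.

Lemma fps_coef_sum (I : Type) (r : seq I) (P : pred I) (F : I -> fps K n) m :
  (\sum_(i <- r | P i) F i) m = \sum_(i <- r | P i) F i m.
Proof. by elim/big_rec2: _ => // i x a _ <-. Qed.

(** Order of vanishing at least d: the filtration in which series converge. *)
Definition fps_ge d a := forall m, (mdeg m < d)%N -> a m = 0.

Lemma fps_ge0 d : fps_ge d 0. Proof. by []. Qed.

Lemma fps_geD d a b : fps_ge d a -> fps_ge d b -> fps_ge d (a + b).
Proof. by move=> ha hb m md; rewrite fps_coefD ha // hb // addr0. Qed.

Lemma fps_geN d a : fps_ge d a -> fps_ge d (- a).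
Proof. by move=> ha m md; rewrite fps_coefN ha // oppr0. Qed.

Lemma fps_geB d a b : fps_ge d a -> fps_ge d b -> fps_ge d (a - b).
Proof. by move=> ha hb; apply/fps_geD/fps_geN. Qed.

Lemma fps_ge_sum d (I : Type) (r : seq I) (F : I -> fps K n) :
  (forall i, fps_ge d (F i)) -> fps_ge d (\sum_(i <- r) F i).
Proof. by move=> hF; elim/big_ind: _ => // a b; apply: fps_geD. Qed.

Lemma fps_geM d e a b : fps_ge d a -> fps_ge e b -> fps_ge (d + e) (a * b).
Proof.
move=> ha hb m md; rewrite [LHS]big1 // => k /eqP mE.
have [/ha ->|dk] := ltnP (mdeg (bmnm k.1)) d; first by rewrite mul0r.
rewrite hb ?mulr0 // -(ltn_add2l d) (leq_ltn_trans _ md) //.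
by rewrite [leqRHS](congr1 mdeg mE) mdegD leq_add2r.
Qed.

Lemma fps_geW d e a : (d <= e)%N -> fps_ge e a -> fps_ge d a.
Proof. by move=> de ha m md; rewrite ha // (leq_trans md). Qed.

Lemma fps_geMr d a b : fps_ge d a -> fps_ge d (a * b).
Proof. by move=> ha; rewrite -[d]addn0; apply: fps_geM. Qed.

Lemma fps_geMl d a b : fps_ge d b -> fps_ge d (a * b).
Proof. by move=> hb; rewrite mulrC; apply: fps_geMr. Qed.

Lemma fps_geX d a : fps_ge 1 a -> fps_ge d (a ^+ d).
Proof.
by move=> ha; elim: d => // d IHd; rewrite exprS -add1n; apply: fps_geM.
Qed.

Lemma fps_ge_deriv d i a : fps_ge d.+1 a -> fps_ge d (fps_deriv i a).
Proof. by move=> ha m md /=; rewrite ha ?mul0rn // mdegD mdeg1 addn1. Qed.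

Lemma fps_ge_eq0 a : (forall d, fps_ge d a) -> a = 0.
Proof. by move=> ha; apply: fpsP => m; apply: (ha (mdeg m).+1). Qed.

(** Completeness of the filtration: from index j on, the coefficients of degree at most j are
    frozen, so degree d of the limit is read off [s d]. *)
Lemma fps_limit (s : nat -> fps K n) :
  (forall j, fps_ge j.+1 (s j.+1 - s j)) ->
  exists a, forall j, fps_ge j.+1 (a - s j).
Proof.
move=> hs; exists (FPS (fun m => s (mdeg m) m)) => j m; rewrite ltnS => mj.
rewrite fps_coefD fps_coefN /=; apply/eqP; rewrite subr_eq0; apply/eqP.
move: mj => /subnK <-; elim: (j - _)%N => // k ->; rewrite addSn.
apply/esym/eqP; rewrite -subr_eq0 -fps_coefN -fps_coefD; apply/eqP/hs.
by rewrite ltnS leq_addl.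
Qed.

(** The inverse is the geometric series in r = 1 - a, which has no constant term. *)
Lemma fps_unit_coef0 a : a 0%MM = 1 -> a \is a GRing.unit.
Proof.
move=> a0; pose r := 1 - a; have rge : fps_ge 1 r.
  move=> m; rewrite ltnS leqn0 mdeg_eq0 => /eqP ->.
  by rewrite fps_coefD fps_coefN fps_coef1 eqxx a0 subrr.
have [j|b hb] := @fps_limit (fun j => \sum_(i < j.+1) r ^+ i).
  by rewrite big_ord_recr addrC addKr; apply: fps_geX.
suff ba1 : b * a = 1 by apply: (fps_unitPl ba1).
apply/eqP; rewrite -subr_eq0; apply/eqP/fps_ge_eq0 => j.
apply: (@fps_geW _ j.+1) => //.
have -> : b * a - 1 = (b - \sum_(i < j.+1) r ^+ i) * a - r ^+ j.+1.
  have : r ^+ j.+1 - 1 = (r - 1) * \sum_(i < j.+1) r ^+ i by exact: subrX1.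
  move=> /(canRL (subrK _)) ->; rewrite /r; ring.
by apply: fps_geB; [apply: fps_geMr | apply: fps_geX].
Qed.

End FormalSeriesOrder.

Section FormalDerivation.
Variables (K : comNzRingType) (n : nat).
Implicit Types (a b c : fps K n) (m : 'X_{1..n}) (f g h : 'cV[fps K n]_n).

Lemma fps_deriv_is_additive i : additive (@fps_deriv K n i).
Proof. by move=> a b; apply: fpsP => m /=; rewrite mulrnBl. Qed.
HB.instance Definition _ i :=
  GRing.isAdditive.Build _ _ (@fps_deriv K n i) (fps_deriv_is_additive i).

Lemma mcoeff_deriv_trunc i a d m : (mdeg m < d)%N ->
  ((fps_trunc d.+1 a)^`M(i))@_m = fps_deriv i a m.
Proof.
by move=> md; rewrite mcoeff_deriv fps_truncE // mdegD mdeg1 addn1 ltnS.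
Qed.

Lemma fps_derivM i a b :
  fps_deriv i (a * b) = fps_deriv i a * b + a * fps_deriv i b.
Proof.
apply: fpsP => m; have md := ltnSn (mdeg m); set d := (mdeg m).+1 in md.
have md1 : (mdeg (m + U_(i)) < d.+1)%N by rewrite mdegD mdeg1 addn1.
transitivity (fps_mul a b (m + U_(i))%MM *+ (m i).+1) => //.
(* The product rule is borrowed from polynomials. The truncation is one degree longer because
   differentiation consumes one. *)
rewrite (fps_mul_trunc _ _ md1) -mcoeff_deriv mderivM mcoeffD.
rewrite fps_coefD; congr (_ + _); rewrite [RHS](fps_mul_trunc _ _ md);
  apply: (mcoeffM_low md) => k kd.
- by rewrite mcoeff_deriv_trunc // fps_truncE.
- by rewrite !fps_truncE // ltnW.
- by rewrite !fps_truncE // ltnW.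
- by rewrite mcoeff_deriv_trunc // fps_truncE.
Qed.

Lemma fps_deriv_comm i j a :
  fps_deriv i (fps_deriv j a) = fps_deriv j (fps_deriv i a).
Proof.
have [->//|ij] := eqVneq i j; apply: fpsP => m /=.
rewrite !mnmDE !mnm1E (negPf ij) eq_sym (negPf ij) !addn0 mulrnAC.
by rewrite -!addmA [(U_(i) + _)%MM]addmC.
Qed.

Lemma lie_derivative_is_additive f : additive (lie_derivative f).
Proof.
move=> a b; rewrite /lie_derivative -sumrB; apply: eq_bigr => i _.
by rewrite raddfB mulrBl.
Qed.
HB.instance Definition _ f :=
  GRing.isAdditive.Build _ _ (lie_derivative f) (lie_derivative_is_additive f).

Lemma lie_derivativeM f a b :
  lie_derivative f (a * b) = lie_derivative f a * b + a * lie_derivative f b.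
Proof.
rewrite /lie_derivative mulr_suml mulr_sumr -big_split /=.
by apply: eq_bigr => i _; rewrite fps_derivM; ring.
Qed.

Lemma lie_derivativeBl f g a :
  lie_derivative (f - g) a = lie_derivative f a - lie_derivative g a.
Proof.
rewrite /lie_derivative -sumrB; apply: eq_bigr => i _.
by rewrite !mxE mulrBr.
Qed.

Lemma lie_derivativeZl f a b :
  lie_derivative (a *: f) b = a * lie_derivative f b.
Proof.
by rewrite /lie_derivative mulr_sumr; apply: eq_bigr => i _; rewrite mxE mulrCA.
Qed.

Lemma lie_bracketE f g i :
  lie_bracket f g i 0 = lie_derivative f (g i 0) - lie_derivative g (f i 0).
Proof.
by rewrite !mxE /lie_derivative; congr (_ - _); apply: eq_bigr => j _;
  rewrite !mxE.
Qed.

(** The second-order terms cancel by symmetry of mixed derivatives; the first-order ones form the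
    bracket. *)
Lemma lie_derivative_comm f g a :
  lie_derivative f (lie_derivative g a) - lie_derivative g (lie_derivative f a)
  = lie_derivative (lie_bracket f g) a.
Proof.
have dd u v : lie_derivative u (lie_derivative v a) =
    \sum_i \sum_j fps_deriv j (fps_deriv i a) * u j 0 * v i 0
    + \sum_i fps_deriv i a * lie_derivative u (v i 0).
  rewrite {2}/lie_derivative raddf_sum -big_split /=; apply: eq_bigr => i _.
  by rewrite lie_derivativeM -mulr_suml.
have sym : \sum_i \sum_j fps_deriv j (fps_deriv i a) * g j 0 * f i 0 =
           \sum_i \sum_j fps_deriv j (fps_deriv i a) * f j 0 * g i 0.
  rewrite exchange_big /=; apply: eq_bigr => i _; apply: eq_bigr => j _.
  by rewrite fps_deriv_comm mulrAC.
rewrite !dd sym opprD addrACA subrr add0r -sumrB; apply: eq_bigr => i _.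
by rewrite -mulrBr lie_bracketE.
Qed.

(** The Jacobi identity as a Leibniz rule for bracketing with f; componentwise it follows from
    [lie_derivative_comm]. *)
Lemma lie_jacobi f g h :
  lie_bracket f (lie_bracket g h) =
  lie_bracket g (lie_bracket f h) + lie_bracket (lie_bracket f g) h.
Proof.
(* Abstracting over the bracket keeps unification from unfolding it. *)
pose V := 'cV[fps K n]_n.
suff jacobi (B : V -> V -> V) (X : V -> {additive fps K n -> fps K n}) :
    (forall u v i, B u v i 0 = X u (v i 0) - X v (u i 0)) ->
    (forall u v a, X u (X v a) - X v (X u a) = X (B u v) a) ->
    B f (B g h) = B g (B f h) + B (B f g) h.
  exact: (jacobi (@lie_bracket K n) (@lie_derivative K n) lie_bracketE
            lie_derivative_comm).
move=> BE XC; apply/colP => i; rewrite [RHS]mxE !BE -!XC !raddfB /=; ring.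
Qed.

Lemma lie_bracketZ f a g :
  lie_bracket f (a *: g) = lie_derivative f a *: g + a *: lie_bracket f g.
Proof.
apply/colP => i; rewrite lie_bracketE [RHS]mxE [(a *: g) i 0]mxE.
rewrite [(_ *: g) i 0]mxE [(a *: lie_bracket f g) i 0]mxE lie_bracketE.
by rewrite lie_derivativeM lie_derivativeZl; ring.
Qed.

Lemma lie_bracketB f g h :
  lie_bracket f (g - h) = lie_bracket f g - lie_bracket f h.
Proof.
apply/colP => i; rewrite [RHS]mxE [(- lie_bracket f h) i 0]mxE !lie_bracketE.
by rewrite lie_derivativeBl [(g - h) i 0]mxE [(- h) i 0]mxE raddfB /=; ring.
Qed.

Lemma lie_bracket0l g : lie_bracket 0 g = 0.
Proof.
apply/colP => i; rewrite lie_bracketE !mxE raddf0 subr0.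
by rewrite /lie_derivative big1 // => j _; rewrite mxE mulr0.
Qed.

End FormalDerivation.

(** * Polynomials inside series, and homogeneous parts *)

Section PolynomialSeries.
Variables (K : comNzRingType) (n : nat).
Implicit Types (p q : {mpoly K[n]}) (a b : fps K n) (m : 'X_{1..n}).
Implicit Types (A : 'M[K]_n) (g : 'cV[fps K n]_n).

Definition mpoly_fps p : fps K n := FPS (fun m => p@_m).

Lemma mpoly_fps_inj : injective mpoly_fps.
Proof.
move=> p q epq; apply/mpolyP => m.
exact: (congr1 (fun a : fps K n => a m) epq).
Qed.

Lemma mpoly_fps_is_additive : additive mpoly_fps.
Proof. by move=> p q; apply: fpsP => m; apply: mcoeffB. Qed.
HB.instance Definition _ :=
  GRing.isAdditive.Build _ _ mpoly_fps mpoly_fps_is_additive.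

Lemma mpoly_fpsM p q : mpoly_fps (p * q) = mpoly_fps p * mpoly_fps q.
Proof. by apply: fpsP => m; apply: mcoeffM. Qed.

Lemma mpoly_fpsC c : mpoly_fps c%:MP = fpsC n c.
Proof.
by apply: fpsP => m; rewrite /= mcoeffC; case: eqP; rewrite ?mulr1 ?mulr0.
Qed.

Lemma mpoly_fpsX i : mpoly_fps 'X_i = @fpsX K n i.
Proof. by apply: fpsP => m; rewrite /= mcoeffX eq_sym. Qed.

Lemma mpoly_fps_deriv i p : mpoly_fps p^`M(i) = fps_deriv i (mpoly_fps p).
Proof. by apply: fpsP => m; apply: mcoeff_deriv. Qed.

Lemma linear_fieldE A i : linear_field A i 0 = mpoly_fps (linform A i).
Proof.
rewrite /linform raddf_sum mxE; apply: eq_bigr => j _.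
by rewrite !mxE /= -mul_mpolyC mpoly_fpsM mpoly_fpsC mpoly_fpsX.
Qed.

Lemma lie_derivative_mpoly A p :
  lie_derivative (linear_field A) (mpoly_fps p) = mpoly_fps (mlinder A p).
Proof.
rewrite /mlinder raddf_sum; apply: eq_bigr => i _.
by rewrite linear_fieldE /= mpoly_fpsM mpoly_fps_deriv.
Qed.

Lemma coef_fpsCM (c : K) a m : (fpsC n c * a) m = c * a m.
Proof.
rewrite -mpoly_fpsC; have md := ltnSn (mdeg m).
transitivity ((c%:MP * fps_trunc (mdeg m).+1 a)@_m); last first.
  by rewrite mul_mpolyC mcoeffZ fps_truncE.
rewrite [LHS](fps_mul_trunc _ _ md); apply: (mcoeffM_low md) => // k kd.
by rewrite fps_truncE.
Qed.

Lemma lie_derivative_linear A g i :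
  lie_derivative g (linear_field A i 0) = \sum_j fpsC n (A i j) * g j 0.
Proof.
rewrite linear_fieldE; apply: eq_bigr => j _; rewrite -mpoly_fps_deriv.
congr (_ * _); rewrite -mpoly_fpsC; congr mpoly_fps.
rewrite /linform linear_sum /= (bigD1 j) //= big1 => [|k kj].
  by rewrite addr0 linearZ /= mderivXU eqxx -mul_mpolyC mulr1.
by rewrite linearZ /= mderivXU eq_sym (negPf kj) scaler0.
Qed.

(* The series counterpart of [mpoly_lie]. *)
Definition linear_lie A c g := lie_bracket (linear_field A) g - fpsC n c *: g.

Lemma linear_lie_coord A c g i : linear_lie A c g i 0 =
  lie_derivative (linear_field A) (g i 0)
  - lie_derivative g (linear_field A i 0) - fpsC n c * g i 0.
Proof.
by rewrite [LHS]mxE [X in _ + X]mxE [X in _ - X]mxE lie_bracketE.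
Qed.

Lemma linear_lieE A c g i : linear_lie A c g i 0 =
  lie_derivative (linear_field A) (g i 0) - \sum_j fpsC n (A i j) * g j 0
  - fpsC n c * g i 0.
Proof.
by rewrite linear_lie_coord lie_derivative_linear.
Qed.

Lemma linear_lie_mpoly A c (v : 'cV[{mpoly K[n]}]_n) :
  linear_lie A c (map_mx mpoly_fps v) = map_mx mpoly_fps (mpoly_lie A c v).
Proof.
apply/colP => i; rewrite linear_lieE !mxE lie_derivative_mpoly !raddfB /=.
rewrite mpoly_fpsM mpoly_fpsC; congr (_ - _ - _); rewrite [RHS]raddf_sum.
by apply: eq_bigr => j _; rewrite !mxE /= mpoly_fpsM mpoly_fpsC.
Qed.

Lemma fps_homog_is_additive d : additive (@fps_homog K n d).
Proof. by move=> a b; apply: fpsP => m /=; case: eqP; rewrite ?subr0. Qed.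
HB.instance Definition _ d :=
  GRing.isAdditive.Build _ _ (@fps_homog K n d) (fps_homog_is_additive d).

Lemma fps_homog_ge d a : fps_ge d (fps_homog d a).
Proof. by move=> m /=; case: eqP => // ->; rewrite ltnn. Qed.

Lemma fps_homog_geS d a : fps_ge d a -> fps_ge d.+1 (a - fps_homog d a).
Proof.
move=> ha m; rewrite ltnS fps_coefD fps_coefN /=.
case: eqP => [_|/eqP md] le_md; first by rewrite subrr.
by rewrite subr0 ha // ltn_neqAle md.
Qed.

Lemma fps_homog_eq0 d a : fps_ge d.+1 a -> fps_homog d a = 0.
Proof.
by move=> ha; apply: fpsP => m /=; case: eqP => // md; rewrite ha // md.
Qed.

Lemma fps_homog_id d p : p \is d.-homog ->
  fps_homog d (mpoly_fps p) = mpoly_fps p.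
Proof.
move=> hp; apply: fpsP => m /=; case: eqP => // /eqP md.
by rewrite (dhomog_nemf_coeff hp).
Qed.

Definition mpoly_homog d a : {mpoly K[n]} := fps_trunc d.+1 (fps_homog d a).

Lemma mpoly_homogE d a : mpoly_fps (mpoly_homog d a) = fps_homog d a.
Proof.
apply: fpsP => m; rewrite [LHS]/=; have [md|md] := ltnP (mdeg m) d.+1.
  by rewrite fps_truncE.
rewrite /mpoly_homog /fps_trunc raddf_sum /= big1 => [|k _].
  by case: eqP => // dE; rewrite dE ltnn in md.
rewrite mcoeffZ mcoeffX.
have [kE|_] := eqVneq (bmnm k) m; last by rewrite mulr0.
by move: (bmdeg k); rewrite kE ltnNge md.
Qed.

Lemma map_mpoly_homog d g :
  map_mx mpoly_fps (map_mx (mpoly_homog d) g) = map_mx (fps_homog d) g.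
Proof. by apply/colP => i; rewrite !mxE mpoly_homogE. Qed.

Lemma map_mpoly_fps_eq0 (v : 'cV[{mpoly K[n]}]_n) :
  map_mx mpoly_fps v = 0 -> v = 0.
Proof.
move=> /colP v0; apply/colP => i; apply: mpoly_fps_inj.
by have := v0 i; rewrite !mxE raddf0.
Qed.

Lemma mpoly_homog_homog d a : mpoly_homog d a \is d.-homog.
Proof.
apply: rpred_sum => k _ /=; case: eqP => kd; last by rewrite scale0r rpred0.
by apply: rpredZ; rewrite dhomogX /= kd.
Qed.

(** A linear field has coefficients of degree 1 only, which makes up exactly for the degree lost by
    differentiating. *)
Lemma lie_derivative_linear_local A a b m :
  (forall k, mdeg k = mdeg m -> a k = b k) ->
  lie_derivative (linear_field A) a m = lie_derivative (linear_field A) b m.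
Proof.
move=> eab; rewrite !fps_coef_sum; apply: eq_bigr => i _.
rewrite linear_fieldE; apply: eq_bigr => k /eqP mE /=.
have [k1|k1] := eqVneq (mdeg (bmnm k.2)) 1%N.
  by rewrite eab // [RHS](congr1 mdeg mE) !mdegD mdeg1 -k1.
have hl : linform A i \is 1.-homog.
  by apply: rpred_sum => j _; apply: rpredZ; rewrite dhomogX /= mdeg1.
by rewrite (dhomog_nemf_coeff hl) ?mulr0.
Qed.

Lemma fps_homog_lie_derivative A d a :
  fps_homog d (lie_derivative (linear_field A) a) =
  lie_derivative (linear_field A) (fps_homog d a).
Proof.
apply: fpsP => m; rewrite [LHS]/=; case: eqP => [md|/eqP md].
  by apply: lie_derivative_linear_local => k /=; rewrite md => ->; rewrite eqxx.
rewrite (@lie_derivative_linear_local _ _ 0 m) ?raddf0 // => k /= ->.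
by rewrite (negPf md).
Qed.

Lemma fps_homogC d c a : fps_homog d (fpsC n c * a) = fpsC n c * fps_homog d a.
Proof.
apply: fpsP => m; rewrite coef_fpsCM.
rewrite -[LHS]/(if mdeg m == d then (fpsC n c * a) m else 0) coef_fpsCM /=.
by case: eqP; rewrite ?mulr0.
Qed.

Lemma fps_homog_linear_lie A c d g :
  map_mx (fps_homog d) (linear_lie A c g) =
  linear_lie A c (map_mx (fps_homog d) g).
Proof.
apply/colP => i; rewrite [LHS]mxE !linear_lieE !raddfB /=.
rewrite fps_homog_lie_derivative fps_homogC raddf_sum !mxE; congr (_ - _ - _).
by apply: eq_bigr => j _; rewrite /= fps_homogC mxE.
Qed.

Lemma lie_derivative_ge (f : 'cV[fps K n]_n) d a :
  (forall i, fps_ge 2 (f i 0)) -> fps_ge d a ->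
  fps_ge d.+1 (lie_derivative f a).
Proof.
move=> hf ha; apply: fps_ge_sum => i; case: d ha => [|d] ha.
  (* In order 0 differentiation cannot lower the order, and the field alone suffices. *)
  by apply/fps_geMl/(fps_geW _ (hf i)).
by rewrite -addn2; apply: fps_geM => //; apply: fps_ge_deriv.
Qed.

End PolynomialSeries.

(** * Normalization *)

Section NormalForm.
Variables (K : fieldType) (n : nat) (A As An : 'M[K]_n).
Hypotheses (hK : real_or_complex K) (hA : jordan_chevalley A As An).
Variable f : 'cV[fps K n]_n.
Hypothesis f_lin : has_linear_part A f.

Lemma nonlinear_part_ge i : fps_ge 2 ((f - linear_field A) i 0).
Proof.
have [f0 f1] := f_lin; rewrite mxE [X in _ + X]mxE -f1 mxE.
have f0i : fps_homog 0 (f i 0) = 0.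
  by have /(congr1 (fun M : 'cV_n => M i 0)) := f0; rewrite mxE [RHS]mxE.
move=> m md; rewrite fps_coefD fps_coefN /=.
case: eqP => [_|md1]; first by rewrite subrr.
have md0 : mdeg m = 0%N by case: (mdeg m) md md1 => [|[|]].
have := congr1 (fun a : fps K n => a m) f0i.
by rewrite /= md0 eqxx subr0.
Qed.

Lemma lie_derivative_linear_ge d a :
  fps_ge d a -> fps_ge d (lie_derivative (linear_field A) a).
Proof.
move=> ha m md; rewrite (@lie_derivative_linear_local _ _ _ _ 0 m) ?raddf0 //.
by move=> k kd; rewrite ha // kd.
Qed.

Lemma lie_derivative_nonlinear_ge d a : fps_ge d a ->
  fps_ge d.+1 (lie_derivative f a - lie_derivative (linear_field A) a).
Proof.
by rewrite -lie_derivativeBl; apply/lie_derivative_ge/nonlinear_part_ge.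
Qed.

Lemma lie_derivative_ge_id d a : fps_ge d a -> fps_ge d (lie_derivative f a).
Proof.
move=> ha.
rewrite -[lie_derivative f a](subrK (lie_derivative (linear_field A) a)).
apply: fps_geD; last exact: lie_derivative_linear_ge.
exact/(fps_geW _ (lie_derivative_nonlinear_ge ha)).
Qed.

Lemma homogeneous_solve d (w : fps K n) : exists2 u, fps_homog d u = u &
  lie_derivative (linear_field As)
    (fps_homog d w + lie_derivative (linear_field A) u) = 0.
Proof.
have [u hu DwAu] := jordan_mlinder_solve hK hA (mpoly_homog_homog d w).
exists (mpoly_fps u); first exact: fps_homog_id.
rewrite -mpoly_homogE lie_derivative_mpoly -raddfD lie_derivative_mpoly.
by rewrite DwAu raddf0.
Qed.

Lemma homogeneous_linear_lie_ker d c v : map_mx (fps_homog d) v = v ->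
  linear_lie A c v = 0 -> linear_lie As c v = 0.
Proof.
rewrite -map_mpoly_homog => <-; rewrite !linear_lie_mpoly => Lv0.
by rewrite (jordan_mpoly_lie_ker hK hA (map_mpoly_fps_eq0 Lv0)) raddf0.
Qed.

Lemma homogeneous_linear_lie_ker2 d c v : map_mx (fps_homog d) v = v ->
  linear_lie As c (linear_lie As c v) = 0 -> linear_lie As c v = 0.
Proof.
rewrite -map_mpoly_homog => <-; rewrite !linear_lie_mpoly => Lv0.
have [_ ssA _ _] := hA.
by rewrite (semisimple_mpoly_lie_ker2 hK ssA (map_mpoly_fps_eq0 Lv0)) raddf0.
Qed.

(** * Degree by degree construction of the normalizing factor *)

Variable lambda : fps K n.

(** The pair s holds the candidates for sigma and the new multiplier; the aim is defect 0. *)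
Let defect (s : fps K n * fps K n) :=
  lie_derivative f s.1 + lambda * s.1 - s.2 * s.1.

Let approx j (s : fps K n * fps K n) :=
  [/\ s.1 0%MM = 1, s.2 0%MM = lambda 0%MM,
      lie_derivative (linear_field As) s.2 = 0 & fps_ge j.+1 (defect s)].

(** Adding u to sigma and v to the multiplier, with v = E_{j+1} + X_A u, cancels the defect E in
    degree j+1; u is chosen so that X_{A_s} kills v. *)
Lemma approx_step j s : approx j s ->
  exists s', [/\ approx j.+1 s', fps_ge j.+1 (s'.1 - s.1)
                 & fps_ge j.+1 (s'.2 - s.2)].
Proof.
case: s => sigma mu [/= sigma0 mu0 Dmu hE]; set E := defect _ in hE.
have [u hu Dv] := homogeneous_solve j.+1 E.
set v := _ + _ in Dv.
have u_ge : fps_ge j.+1 u by rewrite -hu; apply: fps_homog_ge.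
have v_ge : fps_ge j.+1 v.
  by apply: fps_geD; [apply: fps_homog_ge | apply: lie_derivative_linear_ge].
have coef0 (a b : fps K n) : fps_ge j.+1 b -> (a + b) 0%MM = a 0%MM.
  by move=> hb; rewrite fps_coefD hb ?addr0 // mdeg0.
have ge1 (a b : fps K n) : a 0%MM = b 0%MM -> fps_ge 1 (a - b).
  move=> ab m; rewrite ltnS leqn0 mdeg_eq0 => /eqP ->.
  by rewrite fps_coefD fps_coefN ab subrr.
have hE' : fps_ge j.+2 (defect (sigma + u, mu + v)).
  (* Every summand has order at least j+2, since lambda - mu and sigma + u - 1 have no constant term
     while u and v have order at least j+1. *)
  have -> : defect (sigma + u, mu + v) =
      (E - fps_homog j.+1 E)
      + (lie_derivative f u - lie_derivative (linear_field A) u)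
      + (lambda - mu) * u - v * (sigma + u - 1).
    rewrite /E /defect /= raddfD /= -/(defect (sigma, mu)) -/E.
    have -> : fps_homog j.+1 E = v - lie_derivative (linear_field A) u.
      by rewrite /v addrK.
    by rewrite /E /defect /=; ring.
  apply: fps_geB; first apply: fps_geD; first apply: fps_geD.
  - exact: fps_homog_geS.
  - exact: lie_derivative_nonlinear_ge.
  - by rewrite -add1n; apply: fps_geM => //; apply: ge1.
  - rewrite -addn1; apply: fps_geM => //; apply: ge1.
    by rewrite coef0 // sigma0 fps_coef1 eqxx.
exists (sigma + u, mu + v); split=> /=; last 2 first.
- by rewrite addrC addKr.
- by rewrite addrC addKr.
split=> //.
- exact: etrans (coef0 _ _ u_ge) sigma0.
- exact: etrans (coef0 _ _ v_ge) mu0.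
- by rewrite raddfD /= Dmu Dv addr0.
Qed.

Lemma normalizing_factor : exists sigma mu : fps K n,
  [/\ sigma 0%MM = 1, mu 0%MM = lambda 0%MM,
      lie_derivative (linear_field As) mu = 0
    & lie_derivative f sigma + lambda * sigma = mu * sigma].
Proof.
have approx0 : approx 0 (1, fpsC n (lambda 0%MM)).
  have D1 (h : 'cV[fps K n]_n) c : lie_derivative h (fpsC n c) = 0.
    rewrite -mpoly_fpsC /lie_derivative big1 // => i _.
    by rewrite -mpoly_fps_deriv mderivC raddf0 mul0r.
  split=> //=; rewrite ?eqxx //.
  have -> : defect (1, fpsC n (lambda 0%MM)) = lambda - fpsC n (lambda 0%MM).
    rewrite /defect /= !mulr1; have -> : (1 : fps K n) = fpsC n 1.
      by apply: fpsP => m; rewrite fps_coef1 /=; case: eqP.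
    by rewrite D1 add0r.
  move=> m; rewrite ltnS leqn0 mdeg_eq0 => /eqP ->.
  by rewrite fps_coefD fps_coefN /= eqxx subrr.
have /choice[next nextP] (x : nat * (fps K n * fps K n)) : exists s',
    approx x.1 x.2 -> [/\ approx x.1.+1 s', fps_ge x.1.+1 (s'.1 - x.2.1)
                 & fps_ge x.1.+1 (s'.2 - x.2.2)].
  have [/approx_step[s' hs']|nx] := pselect (approx x.1 x.2).
    by exists s'.
  (* Outside approximations any value will do: it only makes [next] total. *)
  by exists x.2.
pose s := fix s j :=
  if j is k.+1 then next (k, s k) else (1, fpsC n (lambda 0%MM)).
have sP j : approx j (s j).
  by elim: j => // j IHj; have [] := nextP (j, s j) IHj.
have [|sigma hsigma] := @fps_limit _ _ (fun j => (s j).1).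
  by move=> j; have [] := nextP (j, s j) (sP j).
have [|mu hmu] := @fps_limit _ _ (fun j => (s j).2).
  by move=> j; have [] := nextP (j, s j) (sP j).
have coef0 (a b : fps K n) j : fps_ge j.+1 (a - b) -> a 0%MM = b 0%MM.
  move=> hab; apply/eqP.
  by rewrite -subr_eq0 -fps_coefN -fps_coefD hab // mdeg0.
exists sigma, mu; split.
- by rewrite (coef0 _ _ _ (hsigma 0%N)); have [] := sP 0%N.
- by rewrite (coef0 _ _ _ (hmu 0%N)); have [] := sP 0%N.
- apply: fps_ge_eq0 => j; have [_ _ Dmu _] := sP j.
  (* A linear field preserves degrees, so up to degree j the series [mu] may be replaced by its
     approximation. *)
  move=> m md; rewrite -[mu](subrK (s j).2) raddfD /= Dmu addr0.
  rewrite (@lie_derivative_linear_local _ _ _ _ 0 m) ?raddf0 // => k kd.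
  by rewrite hmu // kd ltnW.
- apply/eqP; rewrite -subr_eq0; apply/eqP/fps_ge_eq0 => j.
  apply: (@fps_geW _ _ _ j.+1) => //; have [_ _ _ Ej] := sP j.
  (* The limit equation differs from the defect at stage j by terms containing a difference between
     a limit and its approximation. *)
  have -> : lie_derivative f sigma + lambda * sigma - mu * sigma =
      defect (s j) + lie_derivative f (sigma - (s j).1)
      + (lambda - (s j).2) * (sigma - (s j).1) - (mu - (s j).2) * sigma.
    by rewrite raddfB /defect /=; ring.
  apply: fps_geB; first apply: fps_geD; first apply: fps_geD => //.
  + exact: lie_derivative_ge_id.
  + exact: fps_geMl.
  + exact: fps_geMr.
Qed.

(** With f = A + r and c the constant term of mu, [A, u] - c u equals (mu - c) u - [r, u]. Both
    terms have order above d, as r has order at least 2. *)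
Lemma leading_part_eigenfield d (mu : fps K n) (u : 'cV[fps K n]_n) :
  lie_bracket f u = mu *: u -> (forall i, fps_ge d (u i 0)) ->
  linear_lie A (mu 0%MM) (map_mx (fps_homog d) u) = 0.
Proof.
move=> f_u u_ge; rewrite -fps_homog_linear_lie.
apply/colP => k; rewrite [LHS]mxE [RHS]mxE; apply: fps_homog_eq0.
set c := mu 0%MM; pose r := f - linear_field A.
have rk : r k 0 = f k 0 - linear_field A k 0 by rewrite mxE [X in _ + X]mxE.
have f_uk : lie_derivative f (u k 0) - lie_derivative u (f k 0) = mu * u k 0.
  by rewrite -lie_bracketE f_u mxE.
have -> : linear_lie A c u k 0 = (mu - fpsC n c) * u k 0
    - (lie_derivative r (u k 0) - lie_derivative u (r k 0)).
  rewrite linear_lie_coord rk (lie_derivativeBl f) mulrBl -f_uk.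
  rewrite [lie_derivative u (_ - _)]raddfB /=; ring.
apply: fps_geB; last apply: fps_geB.
- rewrite -add1n; apply: fps_geM => // m.
  rewrite ltnS leqn0 mdeg_eq0 => /eqP ->.
  by rewrite fps_coefD fps_coefN /= eqxx subrr.
- by apply: lie_derivative_ge => // j; apply: nonlinear_part_ge.
- apply: fps_ge_sum => j; rewrite -add1n; apply: fps_geM => //.
  exact/fps_ge_deriv/nonlinear_part_ge.
Qed.

Hypothesis f_nf : poincare_dulac_normal_form As f.

(** The order of u = [A_s, g] - c u_0 with u_0 = g is shown to exceed every d;
    [leading_part_eigenfield] applies to u since, by Jacobi and the normal form, u satisfies the
    same equation as g. *)
Lemma normalized_eigenfield (mu : fps K n) (g : 'cV[fps K n]_n) :
  lie_derivative (linear_field As) mu = 0 -> lie_bracket f g = mu *: g ->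
  lie_bracket (linear_field As) g = fpsC n (mu 0%MM) *: g.
Proof.
move=> Dmu f_g; set c := mu 0%MM; pose u := linear_lie As c g.
suff u0 : forall d i, fps_ge d (u i 0).
  apply/eqP; rewrite -subr_eq0; apply/eqP; rewrite -/(linear_lie As c g) -/u.
  by apply/colP => i; rewrite [RHS]mxE; apply: fps_ge_eq0.
have f_u : lie_bracket f u = mu *: u.
  rewrite /u /linear_lie lie_bracketB lie_bracketZ f_g.
  have -> : lie_bracket f (lie_bracket (linear_field As) g) =
      mu *: lie_bracket (linear_field As) g.
    move: (lie_jacobi (linear_field As) f g).
    rewrite f_nf lie_bracket0l addr0 f_g.
    by rewrite lie_bracketZ Dmu scale0r add0r => <-.
  have -> : lie_derivative f (fpsC n c) = 0.
    rewrite -mpoly_fpsC /lie_derivative big1 // => i _.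
    by rewrite -mpoly_fps_deriv mderivC raddf0 mul0r.
  by rewrite scale0r add0r [RHS]scalerBr !scalerA [fpsC n c * _]mulrC.
elim=> [|d IHd] // i.
pose v := map_mx (fps_homog d) u.
have vE : v = linear_lie As c (map_mx (fps_homog d) g).
  by rewrite /v /u fps_homog_linear_lie.
have homK (w : 'cV[fps K n]_n) :
    map_mx (fps_homog d) (map_mx (fps_homog d) w) = map_mx (fps_homog d) w.
  by apply/colP => k; rewrite !mxE; apply: fpsP => m /=; case: eqP.
have Av0 : linear_lie A c v = 0 by apply: leading_part_eigenfield f_u IHd.
have Asv0 : linear_lie As c v = 0.
  exact: (homogeneous_linear_lie_ker (homK _)).
have v0 : v = 0.
  (* As v is itself the image of the degree d part of g under [A_s, .] - c, its vanishing image
     means that the square of this operator kills that part. *)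
  rewrite vE in Asv0 *; exact: (homogeneous_linear_lie_ker2 (homK _)).
rewrite -[u i 0](subrK (fps_homog d (u i 0))); apply: fps_geD.
  exact: fps_homog_geS.
have -> : fps_homog d (u i 0) = v i 0 by rewrite [RHS]mxE.
by rewrite v0 mxE; apply: fps_ge0.
Qed.

End NormalForm.

Theorem theorem4p3p7 (K : fieldType) (hK : real_or_complex K) (n : nat)
    (A As An : 'M[K]_n) (hA : jordan_chevalley A As An)
    (f g : 'cV[fps K n]_n) (lambda : fps K n)
    (f_lin : has_linear_part A f) (f_nf : poincare_dulac_normal_form As f)
    (f_g : lie_bracket f g = lambda *: g) :
  exists sigma lambda' : fps K n,
    let g' := sigma *: g in
    [/\ sigma \is a GRing.unit /\ sigma 0%MM = 1,
        lie_bracket f g' = lambda' *: g',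
        lambda' 0%MM = lambda 0%MM,
        lie_derivative (linear_field As) lambda' = 0
      & lie_bracket (linear_field As) g' = fpsC n (lambda 0%MM) *: g'].
Proof.
have [sigma [mu [sigma0 mu0 Dmu sigmaE]]] :=
  normalizing_factor hK hA f_lin lambda.
have f_g' : lie_bracket f (sigma *: g) = mu *: (sigma *: g).
  rewrite lie_bracketZ f_g !scalerA -scalerDl -sigmaE.
  by rewrite [sigma * _]mulrC.
exists sigma, mu; split=> //.
- by split=> //; apply: fps_unit_coef0.
- by rewrite -mu0; apply: (normalized_eigenfield hK hA f_lin f_nf).
Qed.
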